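(* Let $(\mathcal T,[1],\Delta)$ be a triangulated category and $\xi$ a proper class of triangles. For any triangle $X_1\xrightarrow{f}X\xrightarrow{g}X_2\xrightarrow{h}X_1[1]$ in $\xi$ and any object $Y\in\mathcal T$, there are exact sequences of abelian groups (where $(A,B)=\mathrm{Hom}_{\mathcal T}(A,B)$) $$(X_2,Y)\xrightarrow{(g,Y)}(X,Y)\xrightarrow{(f,Y)}(X_1,Y)\xrightarrow{\widetilde h}\mathrm{Ext}_\xi(X_2,Y)\xrightarrow{\widetilde g}\mathrm{Ext}_\xi(X,Y)\xrightarrow{\widetilde f}\mathrm{Ext}_\xi(X_1,Y)$$ and $$(Y,X_1)\xrightarrow{(Y,f)}(Y,X)\xrightarrow{(Y,g)}(Y,X_2)\xrightarrow{\overline h}\mathrm{Ext}_\xi(Y,X_1)\xrightarrow{\overline f}\mathrm{Ext}_\xi(Y,X)\xrightarrow{\overline g}\mathrm{Ext}_\xi(Y,X_2).$$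
   Context: $(\mathcal T,[1],\Delta)$ denotes a triangulated category with suspension autoequivalence $[1]$ (quasi-inverse $[-1]$) and class $\Delta$ of (distinguished) triangles. A triangle $X\xrightarrow{u}Y\xrightarrow{v}Z\xrightarrow{w}X[1]$ is splitting if $w=0$. A class $\xi\subseteq\Delta$ is a proper class of triangles if: (i) it contains all splitting triangles; (ii) it is closed under isomorphisms of triangles, finite coproducts and suspensions (if $X\xrightarrow{u}Y\xrightarrow{v}Z\xrightarrow{w}X[1]$ is in $\xi$ then so is $X[i]\xrightarrow{(-1)^iu[i]}Y[i]\xrightarrow{(-1)^iv[i]}Z[i]\xrightarrow{(-1)^iw[i]}X[i+1]$ for all $i\in\mathbb Z$); (iii) it is closed under base changes (if $X\to Y\to Z\xrightarrow{w}X[1]$ is in $\xi$ and $\alpha:Z'\to Z$ is any morphism, then the triangle $X\to Y'\to Z'\xrightarrow{w\alpha}X[1]$, its base change along $\alpha$, is in $\xi$) and cobase changes (if moreover $\beta:X\to X'$ is any morphism, then the triangle $X'\to Y'\to Z\xrightarrow{\beta[1]w}X'[1]$, its cobase change along $\beta$, is in $\xi$); (iv) it is saturated: for any triangle $X\to Y\to Z\xrightarrow{w}X[1]$ and any morphism $\alpha:Z'\to Z$ embedded in a triangle $X'\to Z'\xrightarrow{\alpha}Z\to X'[1]$ in $\xi$, if the base change $X\to Y'\to Z'\xrightarrow{w\alpha}X[1]$ is in $\xi$, then $X\to Y\to Z\xrightarrow{w}X[1]$ is in $\xi$. $\mathrm{Ext}_\xi(X,Y)$ is the abelian group (under Baer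 sum) of equivalence classes of triangles $Y\to E\to X\to Y[1]$ in $\xi$, two such triangles being equivalent if there is a morphism of triangles between them which is the identity on $Y$ and on $X$; the zero element is the class of the splitting triangle. The maps: $\widetilde h$ sends $\alpha:X_1\to Y$ to the class of the triangle $Y\to E_2\to X_2\xrightarrow{\alpha[1]h}Y[1]$; $\widetilde g$ and $\widetilde f$ are induced by base change along $g$ and $f$; $\overline h$ sends $\alpha:Y\to X_2$ to the class of the triangle $X_1\to E_1\to Y\xrightarrow{h\alpha}X_1[1]$; $\overline f$ and $\overline g$ are induced by cobase change along $f$ and $g$. *)

(* Defs.v *)
From HB Require Import structures.
From mathcomp Require Import all_boot all_order all_algebra.
From mathcomp Require Import boolp.

Set Implicit Arguments.
Unset Strict Implicit.
Unset Printing Implicit Defensive.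

Import GRing.Theory.
Local Open Scope ring_scope.
Local Open Scope quotient_scope.

Declare Scope cat_scope.
Delimit Scope cat_scope with cat.

(* [compm g f] is "g after f". *)
Record additiveCategory := AdditiveCategory {
  obj :> Type;
  Mor : obj -> obj -> zmodType;
  idm : forall A, Mor A A;
  compm : forall A B C, Mor B C -> Mor A B -> Mor A C;
  compmA : forall A B C D (h : Mor C D) (g : Mor B C) (f : Mor A B),
    compm h (compm g f) = compm (compm h g) f;
  comp1m : forall A B (f : Mor A B), compm (idm B) f = f;
  compm1 : forall A B (f : Mor A B), compm f (idm A) = f;
  compDl : forall A B C (g g' : Mor B C) (f : Mor A B),
    compm (g + g') f = compm g f + compm g' f;
  compDr : forall A B C (g : Mor B C) (f f' : Mor A B),
    compm g (f + f') = compm g f + compm g f';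
  zob : obj;
  idm_zob : idm zob = 0;
  osum : obj -> obj -> obj;
  inj1 : forall A B, Mor A (osum A B);
  inj2 : forall A B, Mor B (osum A B);
  prj1 : forall A B, Mor (osum A B) A;
  prj2 : forall A B, Mor (osum A B) B;
  prj1_inj1 : forall A B, compm (prj1 A B) (inj1 A B) = idm A;
  prj2_inj2 : forall A B, compm (prj2 A B) (inj2 A B) = idm B;
  prj1_inj2 : forall A B, compm (prj1 A B) (inj2 A B) = 0;
  prj2_inj1 : forall A B, compm (prj2 A B) (inj1 A B) = 0;
  inj_prj : forall A B,
    compm (inj1 A B) (prj1 A B) + compm (inj2 A B) (prj2 A B)
    = idm (osum A B)
}.

Arguments Mor {_} _ _.
Arguments idm {_} A.
Arguments compm {_ A B C} g f.
Arguments zob {_}.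
Arguments inj1 {_} A B.
Arguments inj2 {_} A B.
Arguments prj1 {_} A B.
Arguments prj2 {_} A B.

Notation "g \o f" := (compm g f) : cat_scope.
Local Open Scope cat_scope.

Definition is_iso (C : additiveCategory) (A B : C) (f : Mor A B) : Prop :=
  exists g : Mor B A, g \o f = idm A /\ f \o g = idm B.

(* [P] is a coproduct of the family [F] with injections [j]. *)
Definition is_coproduct (C : additiveCategory) (I : Type) (F : I -> C) (P : C)
    (j : forall i, Mor (F i) P) : Prop :=
  forall (Q : C) (q : forall i, Mor (F i) Q),
    exists! m : Mor P Q, forall i, m \o j i = q i.

Record functor (C : additiveCategory) := Functor {
  fobj :> C -> C;
  fmor : forall A B : C, Mor A B -> Mor (fobj A) (fobj B);
  fmor1 : forall A, fmor (idm A) = idm (fobj A);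
  fmorM : forall A B D (g : Mor B D) (f : Mor A B),
    fmor (g \o f) = fmor g \o fmor f
}.

Arguments fmor {C} F {A B} f : rename.

Definition idF (C : additiveCategory) : functor C :=
  @Functor C (fun A => A) (fun _ _ f => f)
    (fun _ => erefl) (fun _ _ _ _ _ => erefl).

Lemma compF1 (C : additiveCategory) (G F : functor C) (A : C) :
  fmor G (fmor F (idm A)) = idm (G (F A)).
Proof. by rewrite !fmor1. Qed.

Lemma compFM (C : additiveCategory) (G F : functor C) (A B D : C)
    (g : Mor B D) (f : Mor A B) :
  fmor G (fmor F (g \o f)) = fmor G (fmor F g) \o fmor G (fmor F f).
Proof. by rewrite !fmorM. Qed.

Definition compF (C : additiveCategory) (G F : functor C) : functor C :=
  @Functor C (fun A => G (F A)) (fun _ _ f => fmor G (fmor F f))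
    (compF1 G F) (@compFM C G F).

Record natIso (C : additiveCategory) (F G : functor C) := NatIso {
  nmap :> forall A : C, Mor (F A) (G A);
  ninv : forall A : C, Mor (G A) (F A);
  ninvK : forall A, ninv A \o nmap A = idm (F A);
  nmapK : forall A, nmap A \o ninv A = idm (G A);
  nmap_nat : forall A B (f : Mor A B), nmap B \o fmor F f = fmor G f \o nmap A
}.

Arguments ninv {C F G} n A : rename.

Record triangle (C : additiveCategory) (S : functor C) := Triangle {
  tX : C;
  tY : C;
  tZ : C;
  tu : Mor tX tY;
  tv : Mor tY tZ;
  tw : Mor tZ (S tX)
}.

Arguments Triangle {C} S {tX tY tZ} tu tv tw.

Definition tri_hom (C : additiveCategory) (S : functor C) (t t' : triangle S)
    (a : Mor (tX t) (tX t')) (b : Mor (tY t) (tY t')) (c : Mor (tZ t) (tZ t')) :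
    Prop :=
  [/\ b \o tu t = tu t' \o a,
      c \o tv t = tv t' \o b
    & fmor S a \o tw t = tw t' \o c].

Definition tri_iso (C : additiveCategory) (S : functor C) (t t' : triangle S) :
    Prop :=
  exists a b c, [/\ @tri_hom C S t t' a b c, is_iso a, is_iso b & is_iso c].

(* The suspension [1] is an autoequivalence with quasi-inverse [-1]. As usual
   (and without loss of generality) the two natural isomorphisms are normalised
   to form an adjoint equivalence, so that the identification of X[1][-1] with
   X[-1][1] is the canonical one. *)
Record triangulatedCategory := TriangulatedCategory {
  acat :> additiveCategory;
  susp : functor acat;
  desusp : functor acat;
  suspD : forall (A B : acat) (f g : Mor A B),
    fmor susp (f + g) = fmor susp f + fmor susp g;
  sunit : natIso (idF acat) (compF desusp susp);
  scounit : natIso (compF susp desusp) (idF acat);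
  susp_adj : forall A, scounit (susp A) \o fmor susp (sunit A) = idm (susp A);
  dist : triangle susp -> Prop;
  dist_iso : forall t t', tri_iso t t' -> dist t -> dist t';
  dist_id : forall A : acat,
    dist (Triangle susp (idm A) (0 : Mor A zob) (0 : Mor zob (susp A)));
  dist_ex : forall (A B : acat) (u : Mor A B),
    exists (D : acat) (v : Mor B D) (w : Mor D (susp A)),
      dist (Triangle susp u v w);
  dist_rot : forall (A B D : acat)
      (u : Mor A B) (v : Mor B D) (w : Mor D (susp A)),
    dist (Triangle susp u v w) <-> dist (Triangle susp v w (- fmor susp u));
  dist_fill : forall (t t' : triangle susp)
      (a : Mor (tX t) (tX t')) (b : Mor (tY t) (tY t')),
    dist t -> dist t' -> b \o tu t = tu t' \o a -> exists c, tri_hom a b c;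
  dist_octahedron : forall (X Y Z X' Y' Z' : acat)
      (u : Mor X Y) (i : Mor Y Z') (i' : Mor Z' (susp X))
      (v : Mor Y Z) (j : Mor Z X') (j' : Mor X' (susp Y))
      (k : Mor Z Y') (k' : Mor Y' (susp X)),
    dist (Triangle susp u i i') -> dist (Triangle susp v j j') ->
    dist (Triangle susp (v \o u) k k') ->
    exists (f : Mor Z' Y') (g : Mor Y' X'),
      [/\ dist (Triangle susp f g (fmor susp i \o j')),
          f \o i = k \o v, k' \o f = i',
          g \o k = j & j' \o g = fmor susp u \o k']
}.

Arguments susp {T} : rename.
Arguments desusp {T} : rename.
Arguments sunit {T} : rename.
Arguments scounit {T} : rename.
Arguments dist {T} t : rename.

Notation "f `[1]" := (fmor susp f) (at level 2, format "f `[1]") : cat_scope.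
Notation tri := (Triangle susp).

Section Suspensions.
Variable T : triangulatedCategory.

Definition shift_nat (F : functor T) (n : nat) : functor T :=
  iter n (compF F) (idF T).

(* X |-> X[i] *)
Definition shift (i : int) : functor T :=
  match i with
  | Posz n => shift_nat susp n
  | Negz n => shift_nat desusp n.+1
  end.

Fixpoint shift_susp_pos (n : nat) (X : T) :
    Mor (shift_nat susp n (susp X)) (susp (shift_nat susp n X)) :=
  match n with
  | 0 => idm (susp X)
  | m.+1 => (shift_susp_pos m X)`[1]
  end.

Fixpoint shift_susp_neg (n : nat) (X : T) :
    Mor (shift_nat desusp n (susp X)) (susp (shift_nat desusp n X)) :=
  match n with
  | 0 => idm (susp X)
  | m.+1 => (ninv scounit (shift_nat desusp m X) \o
             ninv sunit (shift_nat desusp m X))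
            \o fmor desusp (shift_susp_neg m X)
  end.

(* The canonical isomorphism X[1][i] -> X[i][1]: the last map of a triangle
   starting at X[i] must end in X[i][1]. *)
Definition shift_susp (i : int) (X : T) :
    Mor (shift i (susp X)) (susp (shift i X)) :=
  match i with
  | Posz n => shift_susp_pos n X
  | Negz n => shift_susp_neg n.+1 X
  end.

Definition sgn (i : int) : int := (-1) ^+ `|i|%N.

Definition suspend (i : int) (t : triangle (@susp T)) : triangle (@susp T) :=
  tri (fmor (shift i) (tu t) *~ sgn i)
      (fmor (shift i) (tv t) *~ sgn i)
      ((shift_susp i (tX t) \o fmor (shift i) (tw t)) *~ sgn i).

End Suspensions.

(* [pmem_coprod] covers every finite coproduct of triangles, i.e. every triangle
   with an objectwise coproduct cocone (the empty one included).
   A triangle with given third map is unique up to isomorphism, so "the" base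
   (resp. cobase) change is rendered as "every triangle with third map
   [w \o a] (resp. [b`[1] \o w])". *)
Record properClass (T : triangulatedCategory) := ProperClass {
  pmem :> triangle (@susp T) -> Prop;
  pmem_dist : forall t, pmem t -> dist t;
  pmem_split : forall t, dist t -> tw t = 0 -> pmem t;
  pmem_iso : forall t t', tri_iso t t' -> pmem t -> pmem t';
  pmem_coprod : forall (I : finType) (t : I -> triangle (@susp T))
      (s : triangle (@susp T))
      (a : forall i, Mor (tX (t i)) (tX s))
      (b : forall i, Mor (tY (t i)) (tY s))
      (c : forall i, Mor (tZ (t i)) (tZ s)),
    (forall i, tri_hom (a i) (b i) (c i)) ->
    is_coproduct a -> is_coproduct b -> is_coproduct c ->
    (forall i, pmem (t i)) -> pmem s;
  pmem_susp : forall t (i : int), pmem t -> pmem (suspend i t);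
  pmem_base : forall (X Y Z Y' Z' : T)
      (u : Mor X Y) (v : Mor Y Z) (w : Mor Z (susp X)) (a : Mor Z' Z)
      (u' : Mor X Y') (v' : Mor Y' Z'),
    pmem (tri u v w) -> dist (tri u' v' (w \o a)) -> pmem (tri u' v' (w \o a));
  pmem_cobase : forall (X Y Z X' Y' : T)
      (u : Mor X Y) (v : Mor Y Z) (w : Mor Z (susp X)) (b : Mor X X')
      (u' : Mor X' Y') (v' : Mor Y' Z),
    pmem (tri u v w) -> dist (tri u' v' (b`[1] \o w)) ->
    pmem (tri u' v' (b`[1] \o w));
  pmem_saturated : forall (X Y Z X' Y' Z' : T)
      (u : Mor X Y) (v : Mor Y Z) (w : Mor Z (susp X))
      (x : Mor X' Z') (a : Mor Z' Z) (z : Mor Z (susp X'))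
      (u' : Mor X Y') (v' : Mor Y' Z'),
    dist (tri u v w) -> pmem (tri x a z) -> pmem (tri u' v' (w \o a)) ->
    pmem (tri u v w)
}.

Section TriangulatedTheory.
Variable T : triangulatedCategory.
Implicit Types A B D X Y Z : T.

Lemma comp0m A B D (f : Mor A B) : (0 : Mor B D) \o f = 0.
Proof. by apply: (addrI (0 \o f)); rewrite -compDl !addr0. Qed.

Lemma compm0 A B D (g : Mor B D) : g \o (0 : Mor A B) = 0.
Proof. by apply: (addrI (g \o 0)); rewrite -compDr !addr0. Qed.

Lemma compNm A B D (g : Mor B D) (f : Mor A B) : (- g) \o f = - (g \o f).
Proof. by apply: (addrI (g \o f)); rewrite -compDl !subrr comp0m. Qed.

Lemma compmN A B D (g : Mor B D) (f : Mor A B) : g \o (- f) = - (g \o f).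
Proof. by apply: (addrI (g \o f)); rewrite -compDr !subrr compm0. Qed.

Lemma susp0 A B : (0 : Mor A B)`[1] = 0.
Proof. by apply: (addrI 0`[1]); rewrite -suspD !addr0. Qed.

Lemma suspN A B (f : Mor A B) : (- f)`[1] = - f`[1].
Proof. by apply: (addrI f`[1]); rewrite -suspD !subrr susp0. Qed.

Lemma susp_inj A B (f g : Mor A B) : f`[1] = g`[1] -> f = g.
Proof.
move=> fg; have nf := nmap_nat (@sunit T) f; have ng := nmap_nat (@sunit T) g.
rewrite /= in nf ng.
rewrite -[f]comp1m -[g]comp1m -(ninvK (@sunit T) B) /= -!compmA nf ng.
by rewrite fg.
Qed.

Lemma susp_full A B (c : Mor (susp A) (susp B)) : exists e : Mor A B, e`[1] = c.
Proof.
exists ((ninv sunit B \o fmor desusp c) \o sunit A).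
rewrite !fmorM.
have E : (ninv sunit B)`[1] = scounit (susp B).
  have K := congr1 (fmor susp) (nmapK (@sunit T) B).
  rewrite fmorM fmor1 in K.
  by rewrite -[RHS]compm1 -[idm (susp _)]K compmA susp_adj comp1m.
have nc := nmap_nat (@scounit T) c; rewrite /= in nc.
by rewrite E nc -compmA susp_adj compm1.
Qed.

Lemma is_iso_id A : is_iso (idm A).
Proof. by exists (idm A); rewrite comp1m. Qed.

Lemma dist_ex_third X Z (w : Mor Z (susp X)) :
  exists (Y : T) (u : Mor X Y) (v : Mor Y Z), dist (tri u v w).
Proof.
have [C [p [q dC]]] := dist_ex w.
pose e := @scounit T C; pose e' := ninv (@scounit T) C.
have [u uE] := susp_full (- (e' \o p)).
have [v vE] := susp_full (- (q \o e)).
exists (desusp C), u, v; apply/dist_rot/dist_rot.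
have K : e \o e' = idm C := nmapK (@scounit T) C.
apply: dist_iso dC; exists (idm Z), (idm (susp X)), e'; split.
- split=> /=; first by rewrite comp1m compm1.
    by rewrite compm1 uE opprK.
  by rewrite fmor1 comp1m vE opprK -compmA K compm1.
- exact: is_iso_id.
- exact: is_iso_id.
- by exists e; split=> //; exact: (ninvK (@scounit T) C).
Qed.

Lemma dist_third_uniq X Z Y Y' (u : Mor X Y) (v : Mor Y Z)
    (u' : Mor X Y') (v' : Mor Y' Z) (w : Mor Z (susp X)) :
  dist (tri u v w) -> dist (tri u' v' w) ->
  exists e, @tri_hom T susp (tri u v w) (tri u' v' w) (idm X) e (idm Z).
Proof.
move=> /dist_rot/dist_rot d /dist_rot/dist_rot d'.
have [|c []] := @dist_fill T (tri w (- u`[1]) (- v`[1]))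
    (tri w (- u'`[1]) (- v'`[1])) (idm Z) (idm (susp X)) d d'.
  by rewrite /= comp1m compm1.
rewrite /= !(compm1, fmor1, comp1m) compNm compmN => _ c1 c2.
have [e eE] := susp_full c; exists e; split=> /=.
- rewrite compm1; apply: susp_inj; rewrite fmorM eE.
  exact: oppr_inj.
- rewrite comp1m; apply: susp_inj; rewrite fmorM eE.
  exact: oppr_inj.
- by rewrite fmor1 comp1m compm1.
Qed.

Lemma osum_coproduct (F : bool -> T) :
  is_coproduct (P := osum (F true) (F false))
    (fun b => if b return Mor (F b) _ then inj1 _ _ else inj2 _ _).
Proof.
move=> Q q.
exists ((q true \o prj1 _ _) + (q false \o prj2 _ _)); split=> [[]|m mE].
- by rewrite compDl -!compmA prj1_inj1 prj2_inj1 compm1 compm0 addr0.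
- by rewrite compDl -!compmA prj1_inj2 prj2_inj2 compm1 compm0 add0r.
- by rewrite -(mE true) -(mE false) -!compmA -compDr inj_prj compm1.
Qed.

End TriangulatedTheory.

Definition bimap (C : additiveCategory) (A B A' B' : C)
    (f : Mor A A') (g : Mor B B') : Mor (osum A B) (osum A' B') :=
  (inj1 A' B' \o (f \o prj1 A B)) + (inj2 A' B' \o (g \o prj2 A B)).

Definition diag (C : additiveCategory) (A : C) : Mor A (osum A A) :=
  inj1 A A + inj2 A A.

Definition codiag (C : additiveCategory) (A : C) : Mor (osum A A) A :=
  prj1 A A + prj2 A A.

Section Ext.
Variables (T : triangulatedCategory) (xi : properClass T).

(* Triangles Y -> E -> X -> Y[1] in [xi]. *)
Record extTri (X Y : T) := ExtTri {
  eE : T;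
  eu : Mor Y eE;
  ev : Mor eE X;
  ew : Mor X (susp Y);
  ext_mem : xi (tri eu ev ew)
}.

Definition ext_equiv (X Y : T) (t t' : extTri X Y) : Prop :=
  exists e : Mor (eE t) (eE t'),
    @tri_hom T susp (tri (eu t) (ev t) (ew t)) (tri (eu t') (ev t') (ew t'))
      (idm Y) e (idm X).

Lemma ext_equivP (X Y : T) (t t' : extTri X Y) :
  ext_equiv t t' <-> ew t = ew t'.
Proof.
split=> [[e [_ _ /=]]|]; first by rewrite fmor1 comp1m compm1.
case: t t' => [E u v w m] [E' u' v' w' m'] /= ww; rewrite -{}ww in m' *.
by have := dist_third_uniq (pmem_dist m) (pmem_dist m').
Qed.

HB.instance Definition _ (X Y : T) := gen_eqMixin (extTri X Y).
HB.instance Definition _ (X Y : T) := gen_choiceMixin (extTri X Y).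

Definition ext_equivb (X Y : T) : rel (extTri X Y) :=
  fun t t' => `[< ext_equiv t t' >].

Lemma ext_equivb_refl X Y : reflexive (@ext_equivb X Y).
Proof. by move=> t; apply/asboolP/ext_equivP. Qed.

Lemma ext_equivb_sym X Y : symmetric (@ext_equivb X Y).
Proof. by move=> s t; apply/asboolP/asboolP=> /ext_equivP e; apply/ext_equivP. Qed.

Lemma ext_equivb_trans X Y : transitive (@ext_equivb X Y).
Proof.
move=> s t r /asboolP/ext_equivP ts /asboolP/ext_equivP sr.
by apply/asboolP/ext_equivP; rewrite ts.
Qed.

Canonical ext_equiv_rel (X Y : T) : equiv_rel (extTri X Y) :=
  EquivRel (@ext_equivb X Y) (@ext_equivb_refl X Y) (@ext_equivb_sym X Y)
    (@ext_equivb_trans X Y).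

Definition Ext (X Y : T) : Type := {eq_quot (ext_equiv_rel X Y)}.

HB.instance Definition _ (X Y : T) := Choice.on (Ext X Y).
HB.instance Definition _ (X Y : T) := EqQuotient.on (Ext X Y).

Definition ext_class (X Y : T) (t : extTri X Y) : Ext X Y := \pi_(Ext X Y) t.

Lemma ext_classP (X Y : T) (t t' : extTri X Y) :
  ext_class t = ext_class t' <-> ext_equiv t t'.
Proof. by split=> [/eqmodP/asboolP //|e]; apply/eqmodP/asboolP. Qed.

Definition is_base (X Y X' : T) (a : Mor X' X) (t : extTri X Y)
    (t' : extTri X' Y) : Prop := ew t' = ew t \o a.

Definition is_cobase (X Y Y' : T) (b : Mor Y Y') (t : extTri X Y)
    (t' : extTri X Y') : Prop := ew t' = b`[1] \o ew t.

Lemma base_ex (X Y X' : T) (a : Mor X' X) (t : extTri X Y) :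
  exists t', is_base a t t'.
Proof.
have [E [u [v d]]] := dist_ex_third (ew t \o a).
by exists (ExtTri (pmem_base (ext_mem t) d)).
Qed.

Lemma cobase_ex (X Y Y' : T) (b : Mor Y Y') (t : extTri X Y) :
  exists t', is_cobase b t t'.
Proof.
have [E [u [v d]]] := dist_ex_third (b`[1] \o ew t).
by exists (ExtTri (pmem_cobase (ext_mem t) d)).
Qed.

Lemma split_ex (X Y : T) : exists t : extTri X Y, ew t = 0.
Proof.
have [E [u [v d]]] := dist_ex_third (0 : Mor X (susp Y)).
by exists (ExtTri (pmem_split xi d erefl)).
Qed.

Definition base (X Y X' : T) (a : Mor X' X) (t : extTri X Y) : extTri X' Y :=
  sval (cid (base_ex a t)).

Definition cobase (X Y Y' : T) (b : Mor Y Y') (t : extTri X Y) : extTri X Y' :=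
  sval (cid (cobase_ex b t)).

Definition split_tri (X Y : T) : extTri X Y := sval (cid (split_ex X Y)).

Lemma baseP (X Y X' : T) (a : Mor X' X) (t : extTri X Y) :
  is_base a t (base a t).
Proof. by rewrite /base; case: cid. Qed.

Lemma cobaseP (X Y Y' : T) (b : Mor Y Y') (t : extTri X Y) :
  is_cobase b t (cobase b t).
Proof. by rewrite /cobase; case: cid. Qed.

Lemma split_triP (X Y : T) : ew (split_tri X Y) = 0.
Proof. by rewrite /split_tri; case: cid. Qed.

Definition dsum_w (X X' Y Y' : T) (t : extTri X Y) (t' : extTri X' Y') :
    Mor (osum X X') (susp (osum Y Y')) :=
  ((inj1 Y Y')`[1] \o (ew t \o prj1 X X'))
  + ((inj2 Y Y')`[1] \o (ew t' \o prj2 X X')).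

Lemma dsum_mem (X X' Y Y' : T) (t : extTri X Y) (t' : extTri X' Y') :
  xi (tri (bimap (eu t) (eu t')) (bimap (ev t) (ev t')) (dsum_w t t')).
Proof.
pose F (b : bool) := if b then tri (eu t) (ev t) (ew t)
                     else tri (eu t') (ev t') (ew t').
pose s := tri (bimap (eu t) (eu t')) (bimap (ev t) (ev t')) (dsum_w t t').
apply: (@pmem_coprod T xi bool F s _ _ _ _
         (@osum_coproduct T (fun b => tX (F b)))
         (@osum_coproduct T (fun b => tY (F b)))
         (@osum_coproduct T (fun b => tZ (F b)))).
- case; split; rewrite /= ?/bimap ?/dsum_w !compDl -!compmA
    ?prj1_inj1 ?prj2_inj2 ?prj1_inj2 ?prj2_inj1 ?compm1 ?compm0 ?addr0 ?add0r //.
- by case; apply: ext_mem.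
Qed.

Definition dsum (X X' Y Y' : T) (t : extTri X Y) (t' : extTri X' Y') :
    extTri (osum X X') (osum Y Y') := ExtTri (dsum_mem t t').

Definition baer (X Y : T) (t t' : extTri X Y) : extTri X Y :=
  cobase (codiag Y) (base (diag X) (dsum t t')).

Lemma baer_w (X Y : T) (t t' : extTri X Y) : ew (baer t t') = ew t + ew t'.
Proof.
rewrite (cobaseP (codiag Y) _) (baseP (diag X) _) /= /dsum_w /codiag /diag.
rewrite suspD !(compDl, compDr) -!compmA.
rewrite ?prj1_inj1 ?prj2_inj2 ?prj1_inj2 ?prj2_inj1 ?compm0 ?compm1.
rewrite !compmA -!fmorM ?prj1_inj1 ?prj2_inj2 ?prj1_inj2 ?prj2_inj1.
by rewrite !(fmor1, susp0, comp0m, comp1m, compm0, addr0, add0r).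
Qed.

Definition ext_add (X Y : T) (e e' : Ext X Y) : Ext X Y :=
  ext_class (baer (repr e) (repr e')).
Definition ext_zero (X Y : T) : Ext X Y := ext_class (split_tri X Y).
Definition ext_opp (X Y : T) (e : Ext X Y) : Ext X Y :=
  ext_class (base (- idm X) (repr e)).

Lemma ext_w_inj (X Y : T) (e e' : Ext X Y) :
  ew (repr e) = ew (repr e') -> e = e'.
Proof.
by move=> /ext_equivP/ext_classP; rewrite /ext_class !reprK.
Qed.

Lemma ew_repr (X Y : T) (t : extTri X Y) : ew (repr (ext_class t)) = ew t.
Proof. by apply/ext_equivP/ext_classP; rewrite /ext_class reprK. Qed.

Lemma ext_addA X Y : associative (@ext_add X Y).
Proof. by move=> a b c; apply: ext_w_inj; rewrite !(ew_repr, baer_w) addrA. Qed.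

Lemma ext_addC X Y : commutative (@ext_add X Y).
Proof. by move=> a b; apply: ext_w_inj; rewrite !(ew_repr, baer_w) addrC. Qed.

Lemma ext_add0 X Y : left_id (@ext_zero X Y) (@ext_add X Y).
Proof.
by move=> a; apply: ext_w_inj; rewrite !(ew_repr, baer_w) split_triP add0r.
Qed.

Lemma ext_addN X Y : left_inverse (@ext_zero X Y) (@ext_opp X Y) (@ext_add X Y).
Proof.
move=> a; apply: ext_w_inj; rewrite !(ew_repr, baer_w) split_triP.
by rewrite (baseP (- idm X) _) compmN compm1 addNr.
Qed.

HB.instance Definition _ (X Y : T) :=
  GRing.isZmodule.Build (Ext X Y) (@ext_addA X Y) (@ext_addC X Y)
    (@ext_add0 X Y) (@ext_addN X Y).

Definition ext_base (X Y X' : T) (a : Mor X' X) (e : Ext X Y) : Ext X' Y :=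
  ext_class (base a (repr e)).

Definition ext_cobase (X Y Y' : T) (b : Mor Y Y') (e : Ext X Y) : Ext X Y' :=
  ext_class (cobase b (repr e)).

(* The operations on classes do not depend on the chosen representatives. *)
Lemma ext_baseE (X Y X' : T) (a : Mor X' X) (t : extTri X Y) (t' : extTri X' Y) :
  is_base a t t' -> ext_base a (ext_class t) = ext_class t'.
Proof.
move=> tt'; apply/ext_classP/ext_equivP.
by rewrite (baseP a _) ew_repr tt'.
Qed.

Lemma ext_cobaseE (X Y Y' : T) (b : Mor Y Y') (t : extTri X Y)
    (t' : extTri X Y') :
  is_cobase b t t' -> ext_cobase b (ext_class t) = ext_class t'.
Proof.
move=> tt'; apply/ext_classP/ext_equivP.
by rewrite (cobaseP b _) ew_repr tt'.
Qed.

Lemma ext_addE (X Y : T) (t t' : extTri X Y) :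
  ext_class t + ext_class t' = ext_class (baer t t').
Proof.
by apply/ext_classP/ext_equivP; rewrite !baer_w !ew_repr.
Qed.

Section Connecting.
Variables (X1 X X2 : T) (f : Mor X1 X) (g : Mor X X2) (h : Mor X2 (susp X1))
  (fgh : xi (tri f g h)).

(* The triangle Y -> E2 -> X2 -> Y[1] with third map [a`[1] \o h]. *)
Definition connect_co (Y : T) (a : Mor X1 Y) : Ext X2 Y :=
  ext_class (cobase a (ExtTri fgh)).

(* The triangle X1 -> E1 -> Y -> X1[1] with third map [h \o a]. *)
Definition connect_contra (Y : T) (a : Mor Y X2) : Ext Y X1 :=
  ext_class (base a (ExtTri fgh)).

End Connecting.

End Ext.

Definition exact_at (A B C : zmodType) (f : A -> B) (g : B -> C) : Prop :=
  forall b, g b = 0 <-> exists a, f a = b.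

Definition exact_seq6 (A1 A2 A3 A4 A5 A6 : zmodType)
    (d1 : A1 -> A2) (d2 : A2 -> A3) (d3 : A3 -> A4) (d4 : A4 -> A5)
    (d5 : A5 -> A6) : Prop :=
  [/\ zmod_morphism d1, zmod_morphism d2, zmod_morphism d3, zmod_morphism d4
    & zmod_morphism d5] /\
  [/\ exact_at d1 d2, exact_at d2 d3, exact_at d3 d4 & exact_at d4 d5].

(* Main.v *)
(* A class in Ext_xi(X, Y) is determined by the third map X -> Y[1] of any of
   its triangles, so Ext_xi(X, Y) is the subgroup of Hom(X, Y[1]) of the maps
   that complete to a triangle in xi, and the two sequences are subsequences of
   the long exact Hom sequences of the given triangle. What remains is that the
   preimages under composition with g (resp. f[1]) of maps in this subgroup stay
   in it. For g this is saturation. For f[1]: if f[1]w lies in the subgroup and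
   v' is the second map of its triangle, then f[1]wv' = 0, so wv' factors
   through h, hence is in the subgroup by base change; saturation along v' then
   gives w. *)
Require Import Defs.
From mathcomp Require Import all_boot all_order all_algebra.

Set Implicit Arguments.
Unset Strict Implicit.
Unset Printing Implicit Defensive.

Import GRing.Theory.
Local Open Scope cat_scope.

Section HomExactness.
Local Open Scope ring_scope.
Variable T : triangulatedCategory.
Implicit Types A B C D : T.

Lemma compNm_eq0 A B C (g : Mor B C) (f : Mor A B) :
  (- g) \o f = 0 <-> g \o f = 0.
Proof.
by rewrite compNm; split=> [/eqP | ->]; rewrite ?oppr0 // oppr_eq0 => /eqP.
Qed.

(** The square with sides [idm A] and [u] extends to a morphism from the triangle A = A -> 0, so
    [v \o u] factors through [zob]. *)
Lemma dist_comp0 A B C (u : Mor A B) (v : Mor B C) (w : Mor C (susp A)) :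
  dist (tri u v w) -> v \o u = 0.
Proof.
move=> d; have [|c [_ /= + _]] := @dist_fill T (tri (idm A) (0 : Mor A zob) 0)
  (tri u v w) (idm A) u (dist_id A) d; first by [].
by rewrite compm0.
Qed.

(** Its rotation is the identity triangle of [A] with [zob] replaced by [susp zob], which is again a
    zero object. *)
Lemma dist_0id A :
  dist (tri (0 : Mor zob A) (idm A) (0 : Mor A (susp zob))).
Proof.
apply/dist_rot; rewrite susp0 oppr0; apply: dist_iso (dist_id A).
have idS0 : idm (susp zob) = 0 :> Mor (susp zob : T) _.
  by rewrite -fmor1 idm_zob susp0.
exists (idm A), (idm A), 0; split; [split=> /= | | |].
- by [].
- by rewrite comp0m comp0m.
- by rewrite compm0 comp0m.
- exact: is_iso_id.
- exact: is_iso_id.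
- by exists 0; rewrite !compm0 idm_zob idS0.
Qed.

(** If [a] kills [u], then [0] and [a] begin a morphism to the triangle 0 -> D = D; its third
    component is the factor. *)
Lemma dist_weak_cokernel A B C D (u : Mor A B) (v : Mor B C)
    (w : Mor C (susp A)) (a : Mor B D) :
  dist (tri u v w) -> a \o u = 0 <-> exists b, b \o v = a.
Proof.
move=> d; split=> [au0 | [b <-]]; last first.
  by rewrite -compmA (dist_comp0 d) compm0.
have [|c [_ /= cv _]] := @dist_fill T (tri u v w) (tri 0 (idm D) 0) 0 a d
    (dist_0id D).
  by rewrite /= au0 comp0m.
by exists c; rewrite cv comp1m.
Qed.

(** Filling in from the rotated identity triangle D -> 0 -> D[1] yields a map D[1] -> A[1]; fullness
    of the suspension desuspends it, and the two rotation signs cancel. *)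
Lemma dist_weak_kernel A B C D (u : Mor A B) (v : Mor B C)
    (w : Mor C (susp A)) (a : Mor D B) :
  dist (tri u v w) -> v \o a = 0 <-> exists b, u \o b = a.
Proof.
move=> d; split=> [va0 | [b <-]]; last first.
  by rewrite compmA (dist_comp0 d) comp0m.
have [|c [_ _ /=]] := @dist_fill T (tri 0 0 (- (idm D)`[1]))
    (tri v w (- u`[1])) a (0 : Mor zob C)
    (proj1 (dist_rot _ _ _) (dist_id D)) (proj1 (dist_rot _ _ _) d).
  by rewrite /= va0 comp0m.
have [b <-] := susp_full c.
rewrite fmor1 compmN compm1 compNm -fmorM => /oppr_inj/susp_inj ->.
by exists b.
Qed.

End HomExactness.

Section ThirdMap.
Local Open Scope ring_scope.
Variables (T : triangulatedCategory) (xi : properClass T).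
Implicit Types X Y : T.

Definition ext_w X Y (e : Ext xi X Y) : Mor X (susp Y) := ew (repr e).

Lemma eq_ext_w X Y (e e' : Ext xi X Y) : ext_w e = ext_w e' -> e = e'.
Proof. exact: ext_w_inj. Qed.

Lemma ext_w0 X Y : ext_w (0 : Ext xi X Y) = 0.
Proof. by rewrite /ext_w ew_repr split_triP. Qed.

Lemma ext_wD X Y (e e' : Ext xi X Y) : ext_w (e + e') = ext_w e + ext_w e'.
Proof. by rewrite /ext_w ew_repr baer_w. Qed.

Lemma ext_wB X Y (e e' : Ext xi X Y) : ext_w (e - e') = ext_w e - ext_w e'.
Proof. by apply: (addIr (ext_w e')); rewrite -ext_wD !subrK. Qed.

Lemma ext_w_eq0 X Y (e : Ext xi X Y) : e = 0 <-> ext_w e = 0.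
Proof.
split=> [-> | e0]; first exact: ext_w0.
by apply: eq_ext_w; rewrite e0 ext_w0.
Qed.

Lemma ext_w_base X Y X' (a : Mor X' X) (e : Ext xi X Y) :
  ext_w (ext_base a e) = ext_w e \o a.
Proof. by rewrite /ext_w ew_repr (baseP a). Qed.

Lemma ext_w_cobase X Y Y' (b : Mor Y Y') (e : Ext xi X Y) :
  ext_w (ext_cobase b e) = b`[1] \o ext_w e.
Proof. by rewrite /ext_w ew_repr (cobaseP b). Qed.

Lemma ext_base_zmod X Y X' (a : Mor X' X) :
  zmod_morphism (fun e : Ext xi X Y => ext_base a e).
Proof.
move=> e e'; apply: eq_ext_w.
by rewrite ext_wB !ext_w_base ext_wB compDl compNm.
Qed.

Lemma ext_cobase_zmod X Y Y' (b : Mor Y Y') :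
  zmod_morphism (fun e : Ext xi X Y => ext_cobase b e).
Proof.
move=> e e'; apply: eq_ext_w.
by rewrite ext_wB !ext_w_cobase ext_wB compDr compmN.
Qed.

Lemma ext_w_lift X Y (w : Mor X (susp Y)) :
  (forall E (u : Mor Y E) (v : Mor E X), dist (tri u v w) -> xi (tri u v w)) ->
  exists e : Ext xi X Y, ext_w e = w.
Proof.
have [E [u [v d]]] := dist_ex_third w => /(_ _ _ _ d) m.
by exists (ext_class (ExtTri m)); rewrite /ext_w ew_repr.
Qed.

Section Triangle.
Variables (X1 X X2 : T) (f : Mor X1 X) (g : Mor X X2) (h : Mor X2 (susp X1)).
Hypothesis fgh : xi (tri f g h).

Lemma ext_w_connect_co Y (a : Mor X1 Y) : ext_w (connect_co fgh a) = a`[1] \o h.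
Proof. by rewrite /ext_w ew_repr (cobaseP a). Qed.

Lemma ext_w_connect_contra Y (a : Mor Y X2) :
  ext_w (connect_contra fgh a) = h \o a.
Proof. by rewrite /ext_w ew_repr (baseP a). Qed.

Lemma connect_co_zmod Y :
  zmod_morphism (fun a : Mor X1 Y => connect_co fgh a : Ext xi X2 Y).
Proof.
move=> a b; apply: eq_ext_w.
by rewrite ext_wB !ext_w_connect_co suspD suspN compDl compNm.
Qed.

Lemma connect_contra_zmod Y :
  zmod_morphism (fun a : Mor Y X2 => connect_contra fgh a : Ext xi Y X1).
Proof.
move=> a b; apply: eq_ext_w.
by rewrite ext_wB !ext_w_connect_contra compDr compmN.
Qed.

(** Turns a factorisation through [g] among third maps into one in [Ext]: the triangle of [e] is the
    base change along [g] of any triangle on [w]. *)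
Lemma ext_w_lift_base Y (e : Ext xi X Y) (w : Mor X2 (susp Y)) :
  w \o g = ext_w e -> exists e' : Ext xi X2 Y, ext_w e' = w.
Proof.
move=> we; apply: ext_w_lift => E u v d.
have m := ext_mem (repr e); rewrite -/(ext_w e) -we in m.
exact: pmem_saturated d fgh m.
Qed.

Lemma ext_w_lift_cobase Y (e : Ext xi Y X) (w : Mor Y (susp X1)) :
  f`[1] \o w = ext_w e -> exists e' : Ext xi Y X1, ext_w e' = w.
Proof.
move=> we; apply: ext_w_lift => E u v d.
have m := ext_mem (repr e); set v' := ev _ in m.
have /dist_rot/dist_rot dh := pmem_dist fgh.
(* Consecutive maps of the triangle of [e] compose to zero; the sign matches the rotated triangle
   [dh]. *)
have fwv0 : (- f`[1]) \o (w \o v') = 0.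
  have /dist_rot/dist_comp0 := pmem_dist m.
  by rewrite compNm_eq0 -/(ext_w e) -we compmA.
have [c hc] := proj1 (dist_weak_kernel _ dh) fwv0.
(* The base change of the given triangle along [c] is also that of [d] along [v'], since [h \o c] is
   [w \o v']. *)
have [E' [u' [v'' d']]] := dist_ex_third (h \o c).
have := pmem_base fgh d'; rewrite hc => m'.
exact: pmem_saturated d m m'.
Qed.

End Triangle.

End ThirdMap.

Theorem theorem1p4 (T : triangulatedCategory) (xi : properClass T)
    (X1 X X2 : T) (f : Mor X1 X) (g : Mor X X2) (h : Mor X2 (susp X1))
    (fgh : xi (tri f g h)) (Y : T) :
  exact_seq6
    (fun a : Mor X2 Y => a \o g : Mor X Y)
    (fun a : Mor X Y => a \o f : Mor X1 Y)
    (fun a : Mor X1 Y => connect_co fgh a : Ext xi X2 Y)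
    (fun e : Ext xi X2 Y => ext_base g e : Ext xi X Y)
    (fun e : Ext xi X Y => ext_base f e : Ext xi X1 Y) /\
  exact_seq6
    (fun a : Mor Y X1 => f \o a : Mor Y X)
    (fun a : Mor Y X => g \o a : Mor Y X2)
    (fun a : Mor Y X2 => connect_contra fgh a : Ext xi Y X1)
    (fun e : Ext xi Y X1 => ext_cobase f e : Ext xi Y X)
    (fun e : Ext xi Y X => ext_cobase g e : Ext xi Y X2).
Proof.
(* Each exactness claim is a weak kernel or cokernel property of one of these four rotations, read
   through [ext_w]. *)
have d1 := pmem_dist fgh; have d2 := proj1 (dist_rot _ _ _) d1.
have d3 := proj1 (dist_rot _ _ _) d2; have d4 := proj1 (dist_rot _ _ _) d3.
split; split; split.
- by move=> a b; rewrite compDl compNm.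
- by move=> a b; rewrite compDl compNm.
- exact: connect_co_zmod.
- exact: ext_base_zmod.
- exact: ext_base_zmod.
- by move=> a; exact: dist_weak_cokernel d1.
- move=> a; rewrite ext_w_eq0 ext_w_connect_co (dist_weak_cokernel _ d3).
  split=> [[c ca] | [b <-]].
    (* The sign undoes that of the map [- f[1]] in [d3]. *)
    have [b bE] := susp_full (- c)%R; exists b; apply: susp_inj.
    by rewrite fmorM bE -ca compNm compmN.
  by exists (- b`[1])%R; rewrite fmorM compNm compmN opprK.
- move=> e; rewrite ext_w_eq0 ext_w_base (dist_weak_cokernel _ d2).
  split=> [[c ce] | [a <-]]; last by exists (a`[1]); rewrite ext_w_connect_co.
  have [a aE] := susp_full c; exists a.
  by apply: eq_ext_w; rewrite ext_w_connect_co aE.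
- move=> e; rewrite ext_w_eq0 ext_w_base (dist_weak_cokernel _ d1).
  split=> [[w we] | [e' <-]]; last by exists (ext_w e'); rewrite ext_w_base.
  (* So far [w] is only a map into Y[1]; it must also be the third map of a triangle in [xi]. *)
  have [e' e'E] := ext_w_lift_base fgh we.
  by exists e'; apply: eq_ext_w; rewrite ext_w_base e'E.
- by move=> a b; rewrite compDr compmN.
- by move=> a b; rewrite compDr compmN.
- exact: connect_contra_zmod.
- exact: ext_cobase_zmod.
- exact: ext_cobase_zmod.
- by move=> a; exact: dist_weak_kernel d1.
- by move=> a; rewrite ext_w_eq0 ext_w_connect_contra (dist_weak_kernel _ d2).
- move=> e; rewrite ext_w_eq0 ext_w_cobase.
  rewrite -compNm_eq0 (dist_weak_kernel _ d3).
  split=> [[a ae] | [a <-]]; exists a; last by rewrite ext_w_connect_contra.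
  by apply: eq_ext_w; rewrite ext_w_connect_contra.
- move=> e; rewrite ext_w_eq0 ext_w_cobase.
  rewrite -compNm_eq0 (dist_weak_kernel _ d4).
  split=> [[w we] | [e' <-]]; last first.
    by exists (- ext_w e')%R; rewrite ext_w_cobase compNm compmN opprK.
  (* The sign in [d4] moves onto [w], so it is [- w] that gets lifted. *)
  rewrite compNm -compmN in we.
  have [e' e'E] := ext_w_lift_cobase fgh we.
  by exists e'; apply: eq_ext_w; rewrite ext_w_cobase e'E.
Qed.
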